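(* A completely simple semigroup $S$ is LEF (locally embeddable into the class of finite semigroups) if and only if it is locally embeddable into the class of finite completely simple semigroups.
   Context: Maps are written on the right. A semigroup $S$ is called LEF if for every finite subset $H$ of $S$ there exist a finite semigroup $F_H$ and an injective function $f_H: H \to F_H$ such that for all $x,y \in H$ with $xy \in H$ we have $(xy)f_H = (xf_H)(yf_H)$. Let $\mathcal{K}$ be a class of semigroups and $S$ a semigroup in $\mathcal{K}$. $S$ is called locally embeddable into the class of finite $\mathcal{K}$-semigroups if for every finite subset $H$ of $S$ there exist a finite semigroup $F_H \in \mathcal{K}$ and an injective function $f_H: H \to F_H$ such that for all $x,y\in H$ with $xy \in H$ we have $(xy)f_H = (xf_H)(yf_H)$. Here $\mathcal{K}$ is the class of completely simple semigroups. A semigroup $S$ is completely simple if it has no non-trivial ideals (no nonempty $A \subsetneq S$ with $AS \subseteq A$ and $SA \subseteq A$) and it contains a minimal $\mathcal{L}$-class and a minimal $\mathcal{R}$-class with respect to the pre-orders $\le_{\mathcal{L}}$, $\le_{\mathcal{R}}$, where $x \le_{\mathcal{L}} y$ iff $S^1x \subseteq S^1y$ and $x \le_{\mathcal{R}} y$ iff $xS^1 \subseteq yS^1$, with $S^1$ equal to $S$ if $S$ has an identity and to $S$ with an external identity adjoined otherwise. *)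

(* Defs.v *)
From HB Require Import structures.
From mathcomp Require Import all_boot.
From mathcomp Require Import finmap.
From mathcomp Require Import classical_sets.

Set Implicit Arguments.
Unset Strict Implicit.
Unset Printing Implicit Defensive.

Local Open Scope classical_set_scope.
Local Open Scope group_scope.

#[short(type="finSemigroupType")]
HB.structure Definition FinSemigroup := {G of Semigroup G & Finite G}.

Section GreenPreorders.

Variable S : semigroupType.
Implicit Types (x y : S) (s : option S) (A C : set S).

Definition has_identity : Prop := exists e : S, forall x, e * x = x /\ x * e = x.

(* S^1, with [Some x] standing for x in S and [None] for the external identity,
   which belongs to S^1 only if S has no identity of its own. *)
Definition monoid_completion : set (option S) :=
  [set s | s = None -> ~ has_identity].

(* The products s * x and x * s in S^1, which lie in S since x does. *)
Definition S1_mull s x : S := if s is Some t then t * x else x.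
Definition S1_mulr s x : S := if s is Some t then x * t else x.

Definition left_principal x : set S :=
  [set S1_mull s x | s in monoid_completion].
Definition right_principal x : set S :=
  [set S1_mulr s x | s in monoid_completion].

Definition leL x y : Prop := left_principal x `<=` left_principal y.
Definition leR x y : Prop := right_principal x `<=` right_principal y.

Definition is_class (le : S -> S -> Prop) C : Prop :=
  exists x, C = [set y | le x y /\ le y x].

(* Minimality for the order on classes induced by the preorder [le]. *)
Definition minimal_class (le : S -> S -> Prop) C : Prop :=
  is_class le C /\
  forall C', is_class le C' ->
    (forall x y, C' x -> C y -> le x y) -> C' = C.

Definition ideal A : Prop :=
  [/\ A !=set0, forall a x, A a -> A (a * x) & forall a x, A a -> A (x * a)].

Definition completely_simple : Prop :=
  [/\ ~ (exists A, ideal A /\ A `<` [set: S]),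
      exists C, minimal_class leL C
    & exists C, minimal_class leR C].

End GreenPreorders.

Arguments completely_simple : clear implicits.

Definition locally_embeddable_into_finite
    (K : semigroupType -> Prop) (S : semigroupType) : Prop :=
  forall H : {fset S}, exists F : finSemigroupType, K F /\
    exists f : H -> F, injective f /\
      forall x y z : H, val z = val x * val y -> f z = f x * f y.

Definition LEF (S : semigroupType) : Prop :=
  locally_embeddable_into_finite (fun=> True) S.

(* Main.v *)
Require Import Defs.
From mathcomp Require Import all_boot.
From HB Require Import structures.
From mathcomp Require Import fingroup perm finmap boolp classical_sets.

(** Complete simplicity makes every principal one-sided ideal minimal. Hence
    there is an idempotent [e] such that [G = eSe] is a group, and, writing [s']
    for the inverse of [ese] in [G], one has [s s' s = s]. The map
    [s |-> (s s', ese, s' s)] is then an embedding of [S] into the Rees matrix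
    semigroup over [G] with sandwich matrix [p(l, i) = l i]; this is the
    Rees-Suschkewitsch coordinatisation with idempotents as indices.
    If [S] is LEF, a finite part of [G] embeds locally into the group of units
    of a finite local monoid, so a finite part of [S] embeds locally into a
    finite Rees matrix semigroup over a finite group. *)

Set Implicit Arguments.
Unset Strict Implicit.
Unset Printing Implicit Defensive.

Local Open Scope classical_set_scope.
Local Open Scope group_scope.

(** * Principal one-sided ideals and local inverses *)

Section CompletelySimple.

Variable S : semigroupType.
Implicit Types (x y a b e : S) (C : set S).

Lemma leLP x y : leL x y <-> x = y \/ exists u, x = u * y.
Proof.
split=> [xy|[->//|[u ->]] _ [[s|] _ <-] /=].
- have: left_principal x x.
    have [[e idS]|nid] := EM (has_identity S); last by exists None.
    by exists (Some e) => //=; case: (idS x).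
  by move=> /xy[[s|] _ /= <-]; [right; exists s | left].
- by exists (Some (s * u)) => //=; rewrite mulgA.
- by exists (Some u).
Qed.

Lemma leRP x y : leR x y <-> x = y \/ exists u, x = y * u.
Proof.
split=> [xy|[->//|[u ->]] _ [[s|] _ <-] /=].
- have: right_principal x x.
    have [[e idS]|nid] := EM (has_identity S); last by exists None.
    by exists (Some e) => //=; case: (idS x).
  by move=> /xy[[s|] _ /= <-]; [right; exists s | left].
- by exists (Some (u * s)) => //=; rewrite mulgA.
- by exists (Some u).
Qed.

(** The class of any [y] below [x] lies below the class of [x], so minimality identifies the two. *)
Lemma minimal_class_inP (le : S -> S -> Prop) C :
    (forall x, le x x) -> (forall x y z, le x y -> le y z -> le x z) ->
  minimal_class le C -> exists x, forall y, le y x -> le x y.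
Proof.
move=> le_refl le_trans [[x ->] minC]; exists x => y yx.
have: [set z | le y z /\ le z y] y by split.
rewrite (minC [set z | le y z /\ le z y]); [by case | by exists y |].
by move=> u v [_ uy] [xv _]; apply: le_trans uy (le_trans _ _ _ yx xv).
Qed.

Lemma minimal_class_symmetric (le : S -> S -> Prop) x :
    (forall x, le x x) -> (forall x y z, le x y -> le y z -> le x z) ->
    (forall x y, le x y -> le y x) ->
  minimal_class le [set y | le x y /\ le y x].
Proof.
move=> le_refl le_trans le_sym; split=> [|_ [y ->] yx]; first by exists x.
have xy : le y x by apply: yx.
apply/seteqP; split=> z [].
  move=> yz zy; split; last exact: le_trans xy.
  exact: le_trans (le_sym _ _ xy) yz.
move=> xz zx; split; first exact: le_trans xz.
exact: le_trans zx (le_sym _ _ xy).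
Qed.

(** Forward, each equation defines a set of [a] that is an ideal and contains a representative of a
    minimal class, hence is all of [S]. Backward, the equations make both preorders symmetric and
    put every element in every ideal. *)
Lemma completely_simpleP :
  completely_simple S <->
  [/\ exists x : S, True,
      forall a b, exists u, a = a * b * u
    & forall a b, exists u, a = u * b * a].
Proof.
have le_refl T (f : S -> set T) x : f x `<=` f x by [].
have le_trans T (f : S -> set T) x y z :
    f x `<=` f y -> f y `<=` f z -> f x `<=` f z by apply: subset_trans.
split=> [[simpleS [L minL] [R minR]]|[[x0 _] minR minL]].
  have idealT (A : set S) a : ideal A -> A a.
    move=> idA; apply: contrapT => nAa; apply: simpleS; exists A; split=> //.
    by split=> // /(_ a I).
  have [l lP] := minimal_class_inP (le_refl _ _) (le_trans _ _) minL.
  have [r rP] := minimal_class_inP (le_refl _ _) (le_trans _ _) minR.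
  split; first by exists l.
    move=> a; apply: (idealT [set a | forall b, exists u, a = a * b * u]).
    split=> /= [|{}a x aP b|{}a x aP b].
    (* Multiplying by [b * b] leaves [b] as the witness [u] when [leRP] returns an equality. *)
    - exists r => b; have /rP/leRP : leR (r * b * b) r.
        by apply/leRP; right; exists (b * b); rewrite !mulgA.
      by case=> [rE|[u rE]]; [exists b | exists (b * u); rewrite !mulgA].
    - have [u {1}->] := aP (x * b).
      by exists (u * x); rewrite !mulgA.
    - by have [u {1}->] := aP b; exists u; rewrite !mulgA.
  move=> a; apply: (idealT [set a | forall b, exists u, a = u * b * a]).
  split=> /= [|{}a x aP b|{}a x aP b].
  - exists l => b; have /lP/leLP : leL (b * b * l) l.
      by apply/leLP; right; exists (b * b).
    by case=> [lE|[u lE]]; [exists b | exists (u * b); rewrite !mulgA in lE *].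
  - by have [u {1}->] := aP b; exists u; rewrite !mulgA.
  - have [u {1}->] := aP (b * x).
    by exists (x * u); rewrite !mulgA.
split.
- move=> [A [[[a Aa] Ar Al] [_]]]; apply=> b _.
  by have [u ->] := minR b a; apply: Ar; apply: Al.
- exists [set y | leL x0 y /\ leL y x0].
  apply: minimal_class_symmetric (le_refl _ _) (le_trans _ _) _ => x y.
  move=> /leLP[->|[u ->]]; apply/leLP; first by left.
  by right; have [v {1}->] := minL y u; exists v; rewrite mulgA.
- exists [set y | leR x0 y /\ leR y x0].
  apply: minimal_class_symmetric (le_refl _ _) (le_trans _ _) _ => x y.
  move=> /leRP[->|[u ->]]; apply/leRP; first by left.
  by right; have [v {1}->] := minR y u; exists v.
Qed.

Lemma completely_simple_local_inverse :
  completely_simple S ->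
  exists e (inv : S -> S), e * e = e /\
    forall s, [/\ e * inv s = inv s, inv s * e = inv s,
                  e * s * inv s = e, inv s * s * e = e & s * inv s * s = s].
Proof.
move=> /completely_simpleP[[a _] minR minL].
have [e ee] : exists e, e * e = e.
  (* The element [a * u] is idempotent because it also equals [v * a]. *)
  have [u aE] := minR a a; have [v aE'] := minL a a; exists (a * u).
  have auE : a * u = v * a by rewrite {1}aE' -!mulgA [a * (a * u)]mulgA -aE.
  by rewrite {1}auE -mulgA [a * (a * u)]mulgA -aE -auE.
have invP s : exists t, [/\ e * t = t, t * e = t,
    e * s * t = e, t * s * e = e & s * t * s = s].
  (* In the monoid [eSe], [e * y * e] is a right inverse of [e * s * e] and [e * z * e] a left one,
     so they coincide. *)
  have [y eyE] := minR e (s * e); have [z ezE] := minL e (e * s).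
  have sy : e * s * (e * y * e) = e.
    by rewrite !mulgA in eyE *; rewrite -eyE ee.
  have zs : e * (z * e * s * e) = e by rewrite -[z * e * s]mulgA -ezE ee.
  have yz : e * z * e = e * y * e.
    transitivity (e * z * (e * s * (e * y * e))); first by rewrite sy.
    by rewrite -[X in _ = X * y * e]zs !mulgA.
  have ysy : e * y * e * s * (e * y * e) = e * y * e.
    by rewrite -[e * y * e * s]mulgA -mulgA sy.
  exists (e * y * e); split=> //.
  - by rewrite !mulgA ee.
  - by rewrite -!mulgA ee.
  - by rewrite -yz -[RHS]zs !mulgA.
  (* With [s = s * t * w] and [t * s * t = t], one gets [s * t * s = s * (t * s * t) * w = s]. *)
  have [w sE] := minR s (e * y * e); move: (e * y * e) => t in ysy sE *.
  have {1}-> : s * t * s = s * (t * s * t) * w by rewrite {2}sE !mulgA.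
  by rewrite ysy -sE.
by have [inv {}invP] := choice invP; exists e, inv.
Qed.

End CompletelySimple.

(** * Local embeddings as total maps controlled on lists *)

Lemma locally_embeddable_intro (K : semigroupType -> Prop) (S : semigroupType) :
    (forall H : seq S, exists F : finSemigroupType, K F /\
      exists f : S -> F, {in H &, injective f} /\
        {in H &, {morph f : x y / x * y}}) ->
  locally_embeddable_into_finite K S.
Proof.
move=> embS H; have [F [KF [f [f_inj fM]]]] := embS H.
exists F; split=> //; exists (f \o val); split=> [x y /f_inj xy|x y z /= ->].
  by apply: val_inj; apply: xy; apply: valP.
by apply: fM; apply: valP.
Qed.

(** Adjoining [e] to the list makes its subtype inhabited; [e] is then the default that extends the
    partial map to all of [S]. *)
Lemma LEF_total (S : semigroupType) (e : S) (K : seq S) : LEF S ->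
  exists (F : finSemigroupType) (f : S -> F), {in K &, injective f} /\
    {in K &, forall x y, x * y \in K -> f (x * y) = f x * f y}.
Proof.
move=> lefS; pose H := [fset x in e :: K]%fset.
have [F [_ [f [f_inj fM]]]] := lefS H.
have eH : e \in H by rewrite !inE eqxx.
have KH x : x \in K -> x \in H by move=> xK; rewrite !inE xK orbT.
pose h x := insubd [` eH]%fset x : H.
have hE x : x \in K -> val (h x) = x by move=> /KH; apply: insubdK.
exists F, (f \o h); split=> x y xK yK => [/f_inj hxy|xyK].
  by rewrite -(hE x) // hxy hE.
by apply: fM; rewrite !hE.
Qed.

(** * Units of a finite local monoid as permutations *)

Section LocalUnits.

Variables (F : finSemigroupType) (e : F).
Implicit Types (a b x : F).

(* Outside [F e] the identity is used, so that units of [e F e] permute [F]. *)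
Definition local_mulr a x := if x * e == x then x * a else x.

Lemma local_mulrM a b x :
  a * e = a -> local_mulr (a * b) x = local_mulr b (local_mulr a x).
Proof.
rewrite /local_mulr => ae; case: (altP eqP) => [_|/negPf-> //].
by rewrite -mulgA ae eqxx mulgA.
Qed.

Lemma local_mulr1 x : local_mulr e x = x.
Proof. by rewrite /local_mulr; case: eqP. Qed.

(** Multiplication by the inverse cancels [local_mulr a], and an injection of a finite type is a
    permutation. The hypothesis stands under the quantifier on [p] so that [choice] yields a
    permutation for every [a]. *)
Lemma local_unit_perm a : exists p : {perm F},
  (exists b, [/\ a * e = a, b * e = b, a * b = e & b * a = e]) ->
  p =1 local_mulr a.
Proof.
have [[b [ae be ab ba]]|nua] := EM (exists b,
    [/\ a * e = a, b * e = b, a * b = e & b * a = e]); last by exists 1.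
have aK : cancel (local_mulr a) (local_mulr b).
  by move=> x; rewrite -local_mulrM // ab local_mulr1.
by exists (perm (can_inj aK)) => _ x; rewrite permE.
Qed.

End LocalUnits.

(** The units at [f e] are represented by their right action on [F], so [U] is the full permutation
    group. Listing the inverses in [K'] ensures that the images are units. *)
Lemma LEF_local_group (S : semigroupType) (e : S) (inv : S -> S) (K : seq S)
    (G := fun x => e * x = x /\ x * e = x) : LEF S -> e * e = e ->
    (forall x, G x -> [/\ G (inv x), x * inv x = e & inv x * x = e]) ->
  exists (U : finGroupType) (f : S -> U),
    {in K &, forall x y, G x -> G y -> f x = f y -> x = y} /\
    {in K &, forall x y, G x -> G y -> x * y \in K -> f (x * y) = f x * f y}.
Proof.
move=> lefS ee invP; pose K' := e :: K ++ map inv K.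
have [F [f [f_inj fM]]] := LEF_total e K' lefS.
have [p pP] := choice (local_unit_perm (f e)).
have eK' : e \in K' by rewrite inE eqxx.
have KK' x : x \in K -> x \in K' by move=> xK; rewrite inE mem_cat xK orbT.
have invK' x : x \in K -> inv x \in K'.
  by move=> xK; rewrite inE mem_cat map_f ?orbT.
have pE x : x \in K -> G x -> p (f x) =1 local_mulr (f e) (f x).
  move=> xK Gx; apply: pP; exists (f (inv x)).
  have [[_ ie] xi ix] := invP x Gx; have [_ xe] := Gx.
  by split; rewrite -fM ?xe ?ie ?xi ?ix ?eK' ?invK' ?KK'.
exists {perm F}, (p \o f); split=> x y xK yK Gx Gy /=.
  (* At [f e] the permutation given by [x] takes the value [f e * f x = f x], so the action is
     faithful. *)
  move=> /(congr1 (fun q : {perm F} => q (f e))).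
  rewrite !pE // /local_mulr -!fM ?ee ?eqxx ?Gx.1 ?Gy.1 ?eK' ?KK' //.
  by apply: f_inj; apply: KK'.
move=> xyK; apply/permP=> z; rewrite permM !pE //; last first.
  by case: Gx Gy => ex _ [_ ye]; split; [rewrite mulgA ex | rewrite -mulgA ye].
by rewrite fM ?KK' // local_mulrM -?fM ?Gx.2 ?eK' ?KK'.
Qed.

(** * Rees matrix semigroups over a finite group *)

Definition rees (I L : finType) (U : finGroupType) (p : L -> I -> U) : Type :=
  (I * U * L)%type.

Section Rees.

Variables (I L : finType) (U : finGroupType) (p : L -> I -> U).

Definition rees_mul (x y : rees p) : rees p :=
  let: (i, g, l) := x in let: (j, h, m) := y in (i, g * p l j * h, m).

HB.instance Definition _ := Finite.on (rees p).

Lemma rees_mulA : associative rees_mul.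
Proof. by move=> [[i g] l] [[j h] m] [[k u] n]; rewrite /= !mulgA. Qed.

HB.instance Definition _ := isSemigroup.Build (rees p) rees_mulA.

(** Once the outer indices match, the middle coordinate is the solution of a group equation; [i] and
    [l] supply an element. *)
Lemma rees_completely_simple (i : I) (l : L) :
  completely_simple (rees p : semigroupType).
Proof.
apply/completely_simpleP; split; first by exists (i, 1, l).
  move=> [[j g] m] [[k h] n].
  exists (j, (g * p m k * h * p n j)^-1 * g, m).
  by congr (_, _, _); rewrite /= mulKVg.
move=> [[j g] m] [[k h] n].
pose c := p m k * h * p n j * g; exists (j, g * c^-1, m).
by congr (_, _, _); rewrite -[LHS](mulgKV c) !mulgA.
Qed.

End Rees.

Theorem proposition6 (S : semigroupType) (hS : completely_simple S) :
  LEF S <-> locally_embeddable_into_finite completely_simple S.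
Proof.
split=> [lefS|embS H]; last first.
  by have [F [_ embH]] := embS H; exists F.
have [e [inv [ee invP]]] := completely_simple_local_inverse hS.
apply: locally_embeddable_intro => H.
pose G x := e * x = x /\ x * e = x.
have GP x : G x -> [/\ G (inv x), x * inv x = e & inv x * x = e].
  move=> [ex xe]; have [ei ie xi ix _] := invP x.
  by rewrite ex in xi; rewrite -mulgA xe in ix.
pose g s := e * s * e; pose r s := s * inv s; pose q s := inv s * s.
have Gg s : G (g s) by rewrite /G /g !mulgA ee -!mulgA ee.
have GM x y : G x -> G y -> G (x * y).
  by move=> [ex _] [_ ye]; split; [rewrite mulgA ex | rewrite -mulgA ye].
have Gqr s t : G (q s * r t).
  have [ei _ _ _ _] := invP s; have [_ ie _ _ _] := invP t.
  by rewrite /G /q /r !mulgA ei -!mulgA ie.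
have gM s t : g (s * t) = g s * (q s * r t) * g t.
  have -> : g s * (q s * r t) * g t =
      e * (s * (e * inv s) * s) * (t * (inv t * e) * t) * e.
    by rewrite /g /q /r !mulgA.
  have [ei _ _ _ sis] := invP s; have [_ ie _ _ tit] := invP t.
  by rewrite ei ie sis tit /g !mulgA.
(* Expanding the first [s] as [s * inv s * e * s] exposes [e * (s * t) * inv (s * t)], which is [e];
   [qM] is dual. *)
have rM s t : r (s * t) = r s.
  have [_ se _ _ sis] := invP s; have [_ _ sti _ _] := invP (s * t).
  transitivity (s * (inv s * e) * s * t * inv (s * t)).
    by rewrite se sis.
  by rewrite -!mulgA [s * (t * _)]mulgA [e * _]mulgA sti se.
have qM s t : q (s * t) = q t.
  have [et _ _ _ tit] := invP t; have [_ _ _ ist _] := invP (s * t).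
  transitivity (inv (s * t) * (s * t) * (e * inv t) * t).
    by rewrite et -!mulgA [t * (_ * t)]mulgA tit.
  by rewrite [_ * (e * _)]mulgA ist et.
(* One index set serves for rows and columns; [e] provides the default for [idx]. *)
pose J := e :: map r H ++ map q H.
(* The list [K] holds the factors and partial products of [gM], as [fM] is applied once for each of
   its two outer multiplications. *)
pose K := map g H ++ [seq q s * r t | s <- H, t <- H]
  ++ [seq g s * (q s * r t) | s <- H, t <- H]
  ++ [seq g (s * t) | s <- H, t <- H].
have [U [f [f_inj fM]]] := LEF_local_group K lefS ee GP.
pose idx := insubd (SeqSub (mem_head e _) : seq_sub J).
pose p (l i : seq_sub J) := f (val l * val i).
exists (rees p); split.
  by apply: rees_completely_simple; apply: idx.
have idxr s : s \in H -> val (idx (r s)) = r s.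
  by move=> sH; apply: insubdK; rewrite inE mem_cat map_f ?orbT.
have idxq s : s \in H -> val (idx (q s)) = q s.
  by move=> sH; apply: insubdK; rewrite inE mem_cat map_f ?orbT.
have Kg s : s \in H -> g s \in K by move=> sH; rewrite mem_cat map_f.
exists (fun s => (idx (r s), f (g s), idx (q s)) : rees p); split.
  (* Injectivity follows since [s] is recovered from its three coordinates. *)
  have sE s : s = r s * g s * q s.
    have [es se _ _ sis] := invP s.
    transitivity (s * (inv s * e) * s * (e * inv s) * s).
      by rewrite es se !sis.
    by rewrite /r /g /q !mulgA.
  move=> s t sH tH [/(congr1 val) rE /f_inj gE /(congr1 val) qE].
  rewrite !idxr // in rE; rewrite !idxq // in qE.
  by rewrite (sE s) (sE t) rE qE (gE (Kg s sH) (Kg t tH) (Gg s) (Gg t)).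
move=> s t sH tH; congr (_, _, _); rewrite ?rM ?qM //.
have Kqr : q s * r t \in K.
  by rewrite !mem_cat (allpairs_f (fun s t => q s * r t)) ?orbT.
have Kgqr : g s * (q s * r t) \in K.
  by rewrite !mem_cat (allpairs_f (fun s t => g s * (q s * r t))) ?orbT.
have Kgst : g (s * t) \in K.
  by rewrite !mem_cat (allpairs_f (fun s t => g (s * t))) ?orbT.
rewrite /p idxq // idxr // -(fM _ _ (Kg s sH) Kqr (Gg s) (Gqr s t) Kgqr) gM.
rewrite gM in Kgst.
exact: fM Kgqr (Kg t tH) (GM _ _ (Gg s) (Gqr s t)) (Gg t) Kgst.
Qed.
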